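(* Let $c_\alpha,c_z\ge0$, $\ell_c>0$ and $\ell_J\ge0$ be constants, and let $w$ be a graphon with graphon operator $\mathbf{W}$. Assume: (i) $|b(\alpha,z)-b(\alpha',z')|^2\le c_\alpha|\alpha-\alpha'|^2+c_z|z-z'|^2$ for all $(\alpha,z),(\alpha',z')\in A\times\mathbb{R}$, and $\mathbb{E}[\xi_0^2]<\infty$; (ii) for each $z\in\mathbb{R}$, $\alpha\mapsto\mathcal{J}(\alpha,z)$ is continuously differentiable on $A$ and, for all $\alpha,\alpha'\in A$, $z\in\mathbb{R}$ and $\epsilon\in[0,1]$, $\mathcal{J}(\epsilon\alpha+(1-\epsilon)\alpha',z)\le\epsilon\mathcal{J}(\alpha,z)+(1-\epsilon)\mathcal{J}(\alpha',z)-\frac{\ell_c}{2}\epsilon(1-\epsilon)|\alpha-\alpha'|^2$; (iii) $|\partial_\alpha\mathcal{J}(\alpha,z')-\partial_\alpha\mathcal{J}(\alpha,z)|\le\ell_J|z'-z|$ for all $\alpha\in A$, $z,z'\in\mathbb{R}$; (iv) $\sqrt{c_z}\,\|\mathbf{W}\|<1$ and $$\frac{\ell_J}{\ell_c}\cdot\frac{\sqrt{c_\alpha}\,\|\mathbf{W}\|}{1-\sqrt{c_z}\,\|\mathbf{W}\|}<1.$$ Then the graphon game with graphon $w$ has a unique Nash equilibrium.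
   Context: $I=[0,1]$ with Lebesgue measure; $L^2(I)$ is the usual real Lebesgue space. $A\subset\mathbb{R}$ is a nonempty closed convex set of actions, and $\mathbb{A}$ is the set of $\boldsymbol{\alpha}\in L^2(I)$ with values in $A$ (admissible strategy profiles). $\mu_0$ is a mean-zero probability measure on $\mathbb{R}$, $\xi_0\sim\mu_0$; $b:A\times\mathbb{R}\to\mathbb{R}$ and $f:\mathbb{R}\times A\times\mathbb{R}\to\mathbb{R}$ are given functions, and $\mathcal{J}(\alpha,z)=\mathbb{E}[f(b(\alpha,z)+\xi_0,\alpha,z)]$ for $(\alpha,z)\in A\times\mathbb{R}$ (assumed well defined). A graphon is a symmetric Borel measurable square-integrable function $w:I\times I\to\mathbb{R}$; its graphon operator is $[\mathbf{W}g]_x=\int_I w(x,y)g(y)\,dy$ on $L^2(I)$, with operator norm $\|\mathbf{W}\|$. When $\sqrt{c_z}\|\mathbf{W}\|<1$ and (i) holds, for each $\boldsymbol{\alpha}\in\mathbb{A}$ there is a unique $\mathbf{z}\in L^2(I)$ with $z_x=\int_I w(x,y)b(\alpha_y,z_y)\,dy$ for a.e. $x$; it is denoted $\mathbf{Z}\boldsymbol{\alpha}$. A player $x$ using action $\alpha\in A$ while the others use $\boldsymbol{\alpha}$ incurs cost $\mathcal{J}(\alpha,[\mathbf{Z}\boldsymbol{\alpha}]_x)$. A Nash equilibrium for the graphon game is $\hat{\boldsymbol{\alpha}}\in\mathbb{A}$ such that for a.e. $x\in I$, $\mathcal{J}(\hat\alpha_x,[\mathbf{Z}\hat{\boldsymbol{\alpha}}]_x)\le\mathcal{J}(\beta,[\mathbf{Z}\hat{\boldsymbol{\alpha}}]_x)$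 for all $\beta\in A$; uniqueness is as an element of $L^2(I)$. *)

(* Defs.v *)
From HB Require Import structures.
From mathcomp Require Import all_boot all_order all_algebra.
From mathcomp Require Import all_classical all_reals all_analysis.

Set Implicit Arguments.
Unset Strict Implicit.
Unset Printing Implicit Defensive.

Import Order.TTheory GRing.Theory Num.Theory.
Import numFieldNormedType.Exports.

Local Open Scope classical_set_scope.
Local Open Scope ring_scope.

Section unit_interval.
Context (R : realType).

Definition unit_itv : set (measurableTypeR R) := `[0%R, 1%R].

Lemma measurable_unit_itv : measurable unit_itv.
Proof. exact: measurable_itv. Qed.

Lemma lebesgue_measure_unit_itv_lty : (lebesgue_measure unit_itv < +oo)%E.
Proof.
by rewrite /unit_itv lebesgue_measure_itv/=; case: ifP; rewrite -?EFinB ltry.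
Qed.

(* Lebesgue measure on [0,1], as a measure on R that ignores the complement of
   [0,1]: what a function does outside [0,1] is irrelevant for lebI. *)
Definition lebI : {finite_measure set (measurableTypeR R) -> \bar R} :=
  mfrestr measurable_unit_itv lebesgue_measure_unit_itv_lty.

(* Classes of a.e.-equal measurable square-integrable functions; alpha x is the
   value at x of a chosen representative of alpha. *)
Definition L2I : Type := LspaceType2 lebI.

End unit_interval.

Arguments unit_itv : clear implicits.
Arguments lebI : clear implicits.
Arguments L2I : clear implicits.

Section graphon.
Context (R : realType).

Record graphon (w : R -> R -> R) : Prop := Graphon {
  graphon_sym : forall x y, unit_itv R x -> unit_itv R y -> w x y = w y x ;
  graphon_meas : measurable_fun (unit_itv R `*` unit_itv R)
    ((fun p => w p.1 p.2) : measurableTypeR R * measurableTypeR R ->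
                            measurableTypeR R) ;
  graphon_sqint :
    (\int[lebI R \x lebI R]_(p in unit_itv R `*` unit_itv R)
        ((w p.1 p.2) ^+ 2)%:E < +oo)%E
}.

Definition graphon_op (w : R -> R -> R) (g : R -> R) (x : R) : R :=
  \int[lebI R]_(y in unit_itv R) (w x y * g y).

(* The supremum is finite for a graphon: it is at most the L^2 norm of w. *)
Definition graphon_opnorm (w : R -> R -> R) : R :=
  fine (ereal_sup [set 'N[lebI R]_2[EFin \o graphon_op w g]%E
                  | g in [set g : L2I R | ('N[lebI R]_2[EFin \o g] <= 1)%E]]).

End graphon.

Section derivative_on_a_set.
Context (R : realType) (A : set R).

(* Difference quotients only use points of A, so that the derivative is
   one-sided at an endpoint of A. *)
Definition diff_quot_within (g : R -> R) (x : R) : set_system R :=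
  (g y - g x) / (y - x) @[y --> within A x^'].

Definition derive_within (g : R -> R) (x : R) : R := lim (diff_quot_within g x).

Definition continuously_differentiable_on (g : R -> R) : Prop :=
  (forall x, A x -> cvg (diff_quot_within g x)) /\
  {within A, continuous (derive_within g)}.

End derivative_on_a_set.

Section game.
Context (R : realType).

Section cost.
Context d (Omega : measurableType d) (P : probability Omega R).
Context (xi0 : {RV P >-> measurableTypeR R}).
Context (b : R -> R -> R) (f : R -> R -> R -> R).

Definition realized_cost (a z : R) (omega : Omega) : R :=
  f (b a z + xi0 omega) a z.

Definition expected_cost (a z : R) : R := fine 'E_P[realized_cost a z].

End cost.

Definition mean_zero (mu : probability (measurableTypeR R) R) : Prop :=
  mu.-integrable setT (EFin : measurableTypeR R -> \bar R) /\
  (\int[mu]_x (x : R)%:E = 0)%E.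

Definition admissible (A : set R) (alpha : L2I R) : Prop :=
  \forall x \ae lebI R, A (alpha x).

Definition aggregate_equation (w b : R -> R -> R) (alpha z : L2I R) : Prop :=
  \forall x \ae lebI R, z x = graphon_op w (fun y => b (alpha y) (z y)) x.

(* "z = Z alpha" : z is the one and only solution in L^2(I). *)
Definition is_aggregate (w b : R -> R -> R) (alpha z : L2I R) : Prop :=
  unique (aggregate_equation w b alpha) z.

Definition nash_equilibrium (A : set R) (w b J : R -> R -> R)
    (alpha : L2I R) : Prop :=
  admissible A alpha /\
  exists2 z : L2I R, is_aggregate w b alpha z &
    \forall x \ae lebI R, forall beta, A beta ->
      J (alpha x) (z x) <= J beta (z x).

End game.

(* Main.v *)
From HB Require Import structures.
Require Import Defs.
From mathcomp Require Import all_boot all_order all_algebra.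
From mathcomp Require Import all_classical all_reals all_analysis.
From mathcomp Require Import measurable_realfun ring lra.

Import Order.TTheory GRing.Theory Num.Theory.
Import numFieldNormedType.Exports.

Local Open Scope classical_set_scope.
Local Open Scope ring_scope.

Set Implicit Arguments.
Unset Strict Implicit.
Unset Printing Implicit Defensive.

(** Fix z. Strong convexity and differentiability of J(., z) on the closed convex
set A give a unique minimizer phi(z) in A. Writing J' for the derivative in the
action, the first-order conditions at a = phi(z) and a' = phi(z') together with
the strong monotonicity of J' give
  l_c |a - a'|^2 <= (a - a') (J'(a, z) - J'(a', z))
                 <= (a - a') (J'(a', z') - J'(a', z)) <= l_J |a - a'| |z - z'|,
so phi is Lipschitz with constant l_J / l_c ([best_response_lipschitz]).

A profile alpha with aggregate z is a Nash equilibrium exactly when alpha = phi(z)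
almost everywhere, so that equilibria correspond to the solutions z in L^2 of
  z = W (b (phi (z), z)).
The right-hand side is an integral operator of norm ||W|| applied to a Lipschitz
superposition with constant sqrt c_a * l_J / l_c + sqrt c_z. The two smallness
hypotheses say that the product of ||W|| with this constant is below 1, and the
contraction principle in L^2 yields one and only one solution. The iteration is run
on z and not on alpha, because the aggregate of a profile then need not be
constructed separately: the fixed point z is itself the aggregate of phi(z), and
the same estimate with the first argument frozen shows that no other z' solves
z' = W (b (phi (z), z')) ([response_snd_unique]).

Completeness of L^2 is proved in the form used by the contraction principle: a
sequence whose increments decay geometrically in norm converges in norm
([Lnorm2_complete_geometric]), because its increments are almost everywhere
absolutely summable.

Two measurability points need care. The function b is controlled only on actions
in A, and a profile takes its values in A only almost everywhere, so that the
integrand of the aggregate equation may fail to be measurable; integrals are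
therefore compared almost everywhere without any measurability hypothesis
([ae_eq_integral_nonmeasurable]). On the other hand y |-> b (phi (s y)) (t y) is
measurable because (s, t) |-> b (phi s) t is Lipschitz
([measurable_superposition]). *)

(** * Integrals of almost everywhere equal functions *)

Section ae_integral.
Context d (T : measurableType d) (R : realType) (mu : {measure set T -> \bar R}).
Local Open Scope ereal_scope.
Import HBNNSimple.

(** Monotonicity of almost everywhere, stated with mu as a bare measure: it applies
up to conversion when a hypothesis and the goal reach the same measure through
different structures, as happens with [lebI]. *)
Lemma ae_imp (P Q : T -> Prop) : (forall x, P x -> Q x) ->
  (\forall x \ae mu, P x) -> \forall x \ae mu, Q x.
Proof. exact: filterS. Qed.

Lemma ae_imp2 (P1 P2 Q : T -> Prop) : (forall x, P1 x -> P2 x -> Q x) ->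
  (\forall x \ae mu, P1 x) -> (\forall x \ae mu, P2 x) ->
  \forall x \ae mu, Q x.
Proof. exact: filterS2. Qed.

(** The integral of a nonnegative function is the supremum of the integrals of the
simple functions below it. Cutting such a simple function to 0 on a null set does
not change its integral, so null sets are invisible even without measurability. *)
Lemma ae_ge0_le_integral_nonmeasurable (f g : T -> \bar R) :
  (forall x, 0 <= f x) -> (forall x, 0 <= g x) ->
  (\forall x \ae mu, f x <= g x) -> \int[mu]_x f x <= \int[mu]_x g x.
Proof.
move=> f0 g0 [N [mN N0 fgN]].
rewrite (ge0_integralTE _ f0) (ge0_integralTE _ g0).
apply: ge_ereal_sup => _ [h hf <-].
(* The simple function h, cut to 0 on the null set N, lies below g. *)
have mNC : measurable (~` N) by exact: measurableC.
have -> : sintegral mu h = sintegral mu (proj_nnsfun h mNC).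
  rewrite -!integralT_nnsfun; apply: ge0_ae_eq_integral => //=.
  - exact/measurable_EFinP.
  - by apply/measurable_EFinP; exact: measurable_funM.
  - by move=> x _; rewrite lee_fin.
  - by move=> x _; rewrite lee_fin mulr_ge0.
  exists N; split => // x /=; apply: contra_notP => Nx _.
  by rewrite mindicE mem_set// mulr1.
apply: ereal_sup_ubound; exists (proj_nnsfun h mNC) => //= x.
rewrite mindicE.
have [/set_mem Nx|_] := boolP (x \in ~` N); rewrite ?mulr0 ?mulr1//.
by apply: (le_trans (hf x)); apply: contrapT => /fgN.
Qed.

Lemma ae_eq_integral_nonmeasurable (f g : T -> \bar R) :
  (\forall x \ae mu, f x = g x) -> \int[mu]_x f x = \int[mu]_x g x.
Proof.
move=> fg; rewrite (integralE _ _ f) (integralE _ _ g); congr (_ - _);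
  apply/eqP; rewrite eq_le; apply/andP; split;
  apply: ae_ge0_le_integral_nonmeasurable => //;
  by apply: filterS fg => x fgx; rewrite unlock /= fgx.
Qed.
End ae_integral.

(** * The quadratic norm and its lower semicontinuity *)

Section quadratic_norm.
Context d (T : measurableType d) (R : realType) (mu : {measure set T -> \bar R}).
Local Open Scope ereal_scope.

Lemma ge0_le_poweR (r : R) (x y : \bar R) :
  (0 <= r)%R -> 0 <= x -> x <= y -> x `^ r <= y `^ r.
Proof.
move=> r0 x0 xy; apply: gt0_ler_poweR => //; rewrite in_itv/= leey andbT//.
exact: le_trans xy.
Qed.

Lemma Lnorm2_ae_eq (f g : T -> \bar R) :
  (\forall x \ae mu, f x = g x) -> 'N[mu]_2[f] = 'N[mu]_2[g].
Proof.
move=> fg; rewrite unlock; congr (_ `^ _); apply: ae_eq_integral_nonmeasurable.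
by apply: filterS fg => x ->.
Qed.

Lemma Lnorm2_ae_le (f g : T -> \bar R) :
  (\forall x \ae mu, `|f x| <= `|g x|) -> 'N[mu]_2[f] <= 'N[mu]_2[g].
Proof.
move=> fg; rewrite unlock; apply: ge0_le_poweR; rewrite ?invr_ge0//.
  by apply: integral_ge0 => x _; exact: poweR_ge0.
apply: ae_ge0_le_integral_nonmeasurable => [x|x|]; rewrite ?poweR_ge0//.
by apply: filterS fg => x fg; exact: ge0_le_poweR.
Qed.

(** The norm is traded for the integral of the square, to which the convergence
theorems apply. *)
Lemma Lnorm2_leP (f : T -> \bar R) (M : R) : (0 <= M)%R ->
  ('N[mu]_2[f] <= M%:E) = (\int[mu]_x (`|f x| `^ 2) <= (M ^+ 2)%:E).
Proof.
move=> M0; have I0 : 0 <= \int[mu]_x (`|f x| `^ 2).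
  by apply: integral_ge0 => x _; exact: poweR_ge0.
apply/idP/idP => H.
  by rewrite -poweR_Lnorm// -powR_mulrn// -poweR_EFin ge0_le_poweR// Lnorm_ge0.
have -> : M%:E = (M ^+ 2)%:E `^ 2^-1.
  by rewrite poweR_EFin -powR_mulrn// -powRrM mulfV// powRr1.
by rewrite unlock ge0_le_poweR.
Qed.

Lemma measurable_abse_sqr (f : T -> \bar R) : measurable_fun setT f ->
  measurable_fun setT (fun x => `|f x| `^ 2).
Proof.
move=> mf; apply: (@measurableT_comp _ _ _ _ _ _ (fun x => x `^ 2)) => //=.
  exact: measurable_poweR.
exact: measurableT_comp.
Qed.

Lemma cvg_abse_sqr (u : (\bar R)^nat) (l : \bar R) :
  u @ \oo --> l -> `|u n| `^ 2 @[n --> \oo] --> `|l| `^ 2.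
Proof.
have e (x : \bar R) : `|x| `^ 2 = `|x| * `|x|.
  rewrite -[2%R]/(1 + 1)%R poweRD ?poweRe1//.
  by apply: add_neq0_poweRD_def; rewrite gt_eqF.
move=> ul; under eq_fun do rewrite e; rewrite e.
have ul' : `|u n| @[n --> \oo] --> `|l| by exact: cvg_abse.
apply: cvgeM => //.
by case: (l) => [r| |]; rewrite /mule_def//= ?andbF//=; case: eqP.
Qed.

(** Fatou's lemma for the quadratic norm. Extended values are allowed because it is
applied to a series of nonnegative functions not yet known to be finite. *)
Lemma Lnorm2_fatou (f_ : (T -> \bar R)^nat) (f : T -> \bar R) (M : R) :
  (0 <= M)%R -> (forall n, measurable_fun setT (f_ n)) ->
  (forall x, f_ n x @[n --> \oo] --> f x) ->
  (forall n, 'N[mu]_2[f_ n] <= M%:E) -> 'N[mu]_2[f] <= M%:E.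
Proof.
move=> M0 mf cf fM; rewrite Lnorm2_leP//.
have -> : \int[mu]_x (`|f x| `^ 2) =
    \int[mu]_x limn_einf (fun n => `|f_ n x| `^ 2).
  apply: eq_integral => x _.
  have /cvg_limn_einf_sup[-> //] := cvg_abse_sqr (cf x).
apply: (le_trans (fatou mu measurableT _ _)).
- by move=> n; exact: measurable_abse_sqr.
- by move=> n x _; exact: poweR_ge0.
rewrite limn_einf_lim; apply: lime_le; first exact: is_cvg_einfs.
apply: nearW => n; apply: (@le_trans _ _ (\int[mu]_x (`|f_ n x| `^ 2))).
  by apply: ereal_inf_lbound; exists n => //=.
by rewrite -Lnorm2_leP.
Qed.

Lemma Lnorm2_sum_le (v : nat -> T -> R) (a : nat -> R) n :
  (forall k, measurable_fun setT (v k)) ->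
  (forall k, 'N[mu]_2[EFin \o v k] <= (a k)%:E) ->
  'N[mu]_2[EFin \o (fun x => \sum_(0 <= k < n) v k x)%R]
    <= (\sum_(0 <= k < n) a k)%:E.
Proof.
move=> mv va; elim: n => [|n IH].
  rewrite big_geq//; have -> : (fun x => \sum_(0 <= k < 0) v k x)%R = cst 0%R.
    by apply/funext => x; rewrite big_geq.
  by rewrite (_ : _ \o _ = cst 0) ?Lnorm0// eqe.
rewrite big_nat_recr//= [leRHS]EFinD.
have -> : (fun x => \sum_(0 <= k < n.+1) v k x)%R =
    ((fun x => \sum_(0 <= k < n) v k x) \+ v n)%R.
  by apply/funext => x /=; rewrite big_nat_recr.
apply: (le_trans (minkowski_EFin _ _ _ _)); rewrite ?(ler1n _ 2)//.
  exact: measurable_sum.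
by apply: leeD; [exact: IH|exact: va].
Qed.

Lemma geometric_partial_sum_le (C q : R) (n m : nat) : (0 <= C)%R ->
  (0 <= q < 1)%R -> (\sum_(0 <= k < m) C * q ^+ (n + k) <= C * q ^+ n / (1 - q))%R.
Proof.
move=> C0 /andP[q0 q1].
have -> : (\sum_(0 <= k < m) C * q ^+ (n + k) =
    C * q ^+ n * \sum_(0 <= k < m) q ^+ k)%R.
  by rewrite mulr_sumr; apply: eq_bigr => k _; rewrite exprD mulrA.
rewrite ler_wpM2l ?mulr_ge0 ?exprn_ge0//.
have q1' : (0 < 1 - q)%R by rewrite subr_gt0.
rewrite -div1r ler_pdivlMr// mulrC big_mkord.
have -> : ((1 - q) * \sum_(k < m) q ^+ k = 1 - q ^+ m)%R.
  by rewrite -opprB mulNr -subrX1 opprB.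
by rewrite lerBlDr lerDl exprn_ge0.
Qed.

Lemma summable_increments_cvg (u : nat -> R) :
  \sum_(0 <= k <oo) `|u k.+1 - u k|%:E < +oo -> cvgn u.
Proof.
move=> h.
have : cvgn [normed series (telescope u)].
  apply: nondecreasing_is_cvgn.
    by apply: nondecreasing_series => k _ _; exact: normr_ge0.
  exists (fine (\sum_(0 <= k <oo) `|u k.+1 - u k|%:E)) => _ [n _ <-].
  rewrite -lee_fin fineK; last first.
    rewrite ge0_fin_numE//; apply: nneseries_ge0 => k _ _; by rewrite lee_fin.
  rewrite /series/= -sumEFin.
  by apply: nneseries_lim_ge => k _; rewrite lee_fin.
move/normed_cvg => cv.
have -> : u = (fun n => u 0%N + series (telescope u) n)%R.
  by apply/funext => n; exact: eq_sum_telescope.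
by apply: is_cvgD => //; exact: is_cvg_cst.
Qed.

End quadratic_norm.

(** * Completeness and contractions in the space of square-integrable functions *)

Section completeness.
Context d (T : measurableType d) (R : realType) (mu : {measure set T -> \bar R}).
Local Open Scope ereal_scope.

(** The increments have summable norms, so by [Lnorm2_fatou] the sum of their
absolute values has finite norm and is finite almost everywhere; there u converges
absolutely. Applying [Lnorm2_fatou] again, now to u (n + m) - u n as m grows,
bounds the distance from the limit to u n. *)
Lemma Lnorm2_complete_geometric (u : nat -> T -> R) (C q : R) : (0 <= C)%R ->
  (0 <= q < 1)%R -> (forall n, measurable_fun setT (u n)) ->
  (forall n, 'N[mu]_2[EFin \o (u n.+1 \- u n)%R] <= (C * q ^+ n)%:E) ->
  exists2 z : T -> R, measurable_fun setT z &
    forall n, 'N[mu]_2[EFin \o (z \- u n)%R] <= (C * q ^+ n / (1 - q))%:E.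
Proof.
move=> C0 q01 mu_ hu; have /andP[q0 q1] := q01.
have M0 n : (0 <= C * q ^+ n / (1 - q))%R.
  by rewrite divr_ge0 ?mulr_ge0 ?exprn_ge0// subr_ge0 ltW.
pose v (k : nat) (x : T) : R := `|u k.+1 x - u k x|%R.
have mv k : measurable_fun setT (v k).
  by apply: measurableT_comp => //; exact: measurable_funB.
have Nv k : 'N[mu]_2[EFin \o v k] <= (C * q ^+ k)%:E.
  apply: (le_trans _ (hu k)); rewrite le_eqVlt; apply/orP; left; apply/eqP.
  rewrite -(Lnorm_abse mu (EFin \o (u k.+1 \- u k)%R)).
  by apply: eq_Lnorm => x /=.
pose S (n : nat) (x : T) : R := (\sum_(0 <= k < n) v k x)%R.
have mS n : measurable_fun setT (S n) by exact: measurable_sum.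
have NS n : 'N[mu]_2[EFin \o S n] <= (C / (1 - q))%:E.
  apply: (le_trans (Lnorm2_sum_le n mv Nv)); rewrite lee_fin.
  by have := geometric_partial_sum_le 0 n C0 q01; rewrite expr0 mulr1.
pose Sy (x : T) : \bar R := \sum_(0 <= k <oo) (v k x)%:E.
have cS x : (S n x)%:E @[n --> \oo] --> Sy x.
  rewrite /S; under eq_fun do rewrite -sumEFin.
  by apply: is_cvg_nneseries => k _ _; rewrite lee_fin normr_ge0.
have mSy : measurable_fun setT Sy.
  apply: (@emeasurable_fun_cvg _ _ _ _ (fun n => EFin \o S n)) => [n|x _].
    exact/measurable_EFinP.
  exact: cS.
have NSy : 'N[mu]_2[Sy] <= (C / (1 - q))%:E.
  apply: (@Lnorm2_fatou _ _ _ _ (fun n => EFin \o S n)) => //.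
    by have := M0 0%N; rewrite expr0 mulr1.
  by move=> n; exact/measurable_EFinP.
have Sy_fin : \forall x \ae mu, Sy x < +oo.
  have : mu.-integrable setT (fun x => `|Sy x| `^ 2).
    apply/integrableP; split; first exact: (measurable_abse_sqr mSy).
    under eq_integral do rewrite gee0_abs ?poweR_ge0//.
    rewrite Lnorm2_leP in NSy; last by have := M0 0%N; rewrite expr0 mulr1.
    by rewrite (le_lt_trans NSy)// ltry.
  move/integrable_ae => /(_ measurableT); apply: filterS => x /(_ I).
  by rewrite ltey; apply: contraTneq => ->; rewrite gee0_abs ?leey// poweRyr.
(* Off the null complement of E the sequence is replaced by 0, so that it
   converges everywhere. *)
pose E := [set x | Sy x < +oo].
have mE : measurable E.
  by rewrite -[E]setTI; exact: emeasurable_fun_infty_o.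
have cu x : E x -> cvgn (u ^~ x) by move=> /summable_increments_cvg.
pose z (x : T) : R := if x \in E then limn (u ^~ x) else 0%R.
have zu x : (u n \_ E) x @[n --> \oo] --> z x.
  rewrite /patch /z; case: ifPn => [/set_mem /cu//|_]; exact: cvg_cst.
have mz : measurable_fun setT z.
  apply: (@measurable_fun_cvg _ _ _ _ (fun n => u n \_ E)) => //.
  by move=> n; apply/(measurable_restrictT _ _).1 => //; exact: measurable_funTS.
exists z => // n.
rewrite (@Lnorm2_ae_eq _ _ _ _ _ (EFin \o ((z \- u n) \_ E)%R)); last first.
  by apply: filterS Sy_fin => x Ex /=; rewrite patchE mem_set.
apply: (@Lnorm2_fatou _ _ _ _ (fun m => EFin \o ((u (n + m)%N \- u n) \_ E)%R)) => //.
- move=> m; apply/measurable_EFinP/(measurable_restrictT _ _).1 => //.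
  by apply: measurable_funTS; exact: measurable_funB.
- move=> x /=; apply: cvg_EFin; first exact: nearW.
  rewrite /comp /= /patch; case: ifPn => xE; last exact: cvg_cst.
  apply: cvgB; last exact: cvg_cst.
  have := zu x; rewrite /patch xE => h.
  under eq_fun do rewrite addnC.
  exact: (cvg_comp _ _ (cvg_addnr n) h).
- move=> m.
  rewrite (@Lnorm2_ae_eq _ _ _ _ _ (EFin \o (u (n + m)%N \- u n)%R)); last first.
    by apply: filterS Sy_fin => x Ex /=; rewrite patchE mem_set.
  have -> : (u (n + m)%N \- u n)%R =
      (fun x => \sum_(0 <= k < m) (u (n + k).+1 x - u (n + k) x))%R.
    apply/funext => x /=; under eq_bigr do rewrite -addnS.
    by rewrite (telescope_sumr (fun k => u (n + k)%N x))// addn0.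
  apply: (le_trans (@Lnorm2_sum_le _ _ _ _
    (fun k x => u (n + k).+1 x - u (n + k) x)%R _ m _ (fun k => hu (n + k)%N))).
    by move=> k; exact: measurable_funB.
  by rewrite lee_fin geometric_partial_sum_le.
Qed.

End completeness.

Section contraction_principle.
Context d (T : measurableType d) (R : realType) (mu : {measure set T -> \bar R}).
Local Open Scope ereal_scope.
Local Notation L2 := (Lfun mu 2%:E).

Lemma Lfun2P (f : T -> R) : f \in L2 <->
  measurable_fun setT f /\ 'N[mu]_2[EFin \o f] < +oo.
Proof.
rewrite inE; split=> [/andP[]|[mf Nf]]; first by rewrite !inE.
by apply/andP; rewrite !inE.
Qed.

Lemma Lnorm2D_le (f g : T -> R) :
  measurable_fun setT f -> measurable_fun setT g ->
  'N[mu]_2[EFin \o (f \+ g)%R] <= 'N[mu]_2[EFin \o f] + 'N[mu]_2[EFin \o g].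
Proof. by move=> mf mg; apply: minkowski_EFin; rewrite ?(ler1n _ 2). Qed.

Lemma Lnorm2B_sym (f g : T -> R) :
  'N[mu]_2[EFin \o (f \- g)%R] = 'N[mu]_2[EFin \o (g \- f)%R].
Proof.
rewrite -(oppe_Lnorm mu (EFin \o (f \- g)%R)).
by apply: eq_Lnorm => x /=; rewrite opprB.
Qed.

Lemma Lnorm2_triangle (g f h : T -> R) : measurable_fun setT f ->
  measurable_fun setT g -> measurable_fun setT h ->
  'N[mu]_2[EFin \o (f \- h)%R] <=
  'N[mu]_2[EFin \o (f \- g)%R] + 'N[mu]_2[EFin \o (g \- h)%R].
Proof.
move=> mf mg mh; rewrite (_ : (f \- h)%R = ((f \- g) \+ (g \- h))%R); last first.
  by apply/funext => x /=; rewrite addrA subrK.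
by apply: Lnorm2D_le; exact: measurable_funB.
Qed.

Lemma Lfun2B (f g : T -> R) : f \in L2 -> g \in L2 -> (f \- g)%R \in L2.
Proof.
move=> /Lfun2P[mf Nf] /Lfun2P[mg Ng]; apply/Lfun2P.
split; first exact: measurable_funB.
rewrite (le_lt_trans (Lnorm2D_le mf _))//; first exact: measurable_funN.
rewrite lte_add_pinfty//.
by rewrite (_ : _ \o _ = \- (EFin \o g))// oppe_Lnorm.
Qed.

Lemma Lfun2_norm_fin (f : T -> R) : f \in L2 -> 'N[mu]_2[EFin \o f] \is a fin_num.
Proof. by move=> /Lfun2P[_ ?]; rewrite ge0_fin_numE// Lnorm_ge0. Qed.

Lemma Lfun2_of_sqr_integrable (f : T -> R) : measurable_fun setT f ->
  \int[mu]_x (f x ^+ 2)%:E < +oo -> f \in L2.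
Proof.
move=> mf h; apply/Lfun2P; split => //.
rewrite unlock poweR_lty//; apply: le_lt_trans h.
rewrite le_eqVlt; apply/orP; left; apply/eqP; apply: eq_integral => x _.
by rewrite /= powR_mulrn// real_normK// num_real.
Qed.

Lemma Lnorm2Z (c : R) (f : T -> R) : f \in L2 ->
  'N[mu]_2[EFin \o (fun x => c * f x)%R] = `|c|%:E * 'N[mu]_2[EFin \o f].
Proof. by move=> f2; exact: (LnormZ (Lfun_Sub (lee1n 2) f2) c). Qed.

Lemma Lfun2D (f g : T -> R) : f \in L2 -> g \in L2 -> (f \+ g)%R \in L2.
Proof.
move=> /Lfun2P[mf Nf] /Lfun2P[mg Ng]; apply/Lfun2P.
split; first exact: measurable_funD.
by rewrite (le_lt_trans (Lnorm2D_le mf mg))// lte_add_pinfty.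
Qed.

Lemma Lfun2Z (c : R) (f : T -> R) : f \in L2 -> (fun x => c * f x)%R \in L2.
Proof.
move=> f2; have /Lfun2P[mf Nf] := f2; apply/Lfun2P.
split; first exact: measurable_funM.
by rewrite Lnorm2Z// lte_mul_pinfty// lee_fin.
Qed.

Lemma Lfun2_norm (f : T -> R) : f \in L2 -> (fun x => `|f x|%R) \in L2.
Proof.
move=> /Lfun2P[mf Nf]; apply/Lfun2P; split; first exact: measurableT_comp.
apply: le_lt_trans Nf; apply: Lnorm2_ae_le; apply: nearW => x /=.
by rewrite normr_id.
Qed.

Lemma Lnorm2_sub_eq0 (f g : T -> R) :
  measurable_fun setT f -> measurable_fun setT g ->
  'N[mu]_2[EFin \o (f \- g)%R] = 0 -> \forall x \ae mu, f x = g x.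
Proof.
move=> mf mg /Lnorm_eq0_eq0; have m : measurable_fun setT (EFin \o (f \- g)%R).
  by apply/measurable_EFinP; exact: measurable_funB.
move=> /(_ m); rewrite lte_fin ltr0n => /(_ isT).
by apply: filterS => x /(_ I)/= [] /eqP; rewrite subr_eq0 => /eqP.
Qed.

Lemma Lfun2_contraction_unique (q : R) (f g : T -> R) : (q < 1)%R ->
  f \in L2 -> g \in L2 ->
  'N[mu]_2[EFin \o (f \- g)%R] <= q%:E * 'N[mu]_2[EFin \o (f \- g)%R] ->
  \forall x \ae mu, f x = g x.
Proof.
move=> q1 f2 g2 h; have /Lfun2P[mf _] := f2; have /Lfun2P[mg _] := g2.
apply: Lnorm2_sub_eq0 => //.
have := Lfun2_norm_fin (Lfun2B f2 g2).
have := Lnorm_ge0 mu 2%:E (EFin \o (f \- g)%R).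
case: ('N[mu]_2[_]) h => [r| |]//; rewrite -EFinM !lee_fin => h r0 _.
congr EFin; apply/eqP; rewrite eq_le r0 andbT.
by rewrite -(@pmulr_rle0 _ (1 - q)) ?subr_gt0// mulrBl mul1r subr_le0.
Qed.

(** Picard iteration from 0. Phi acts on functions, not on classes, hence the
fixed-point equation holds almost everywhere only. *)
Lemma Lfun2_contraction_fixpoint (Phi : (T -> R) -> T -> R) (q : R) :
  (0 <= q < 1)%R -> (forall f, f \in L2 -> Phi f \in L2) ->
  (forall f g, f \in L2 -> g \in L2 -> 'N[mu]_2[EFin \o (Phi f \- Phi g)%R]
      <= q%:E * 'N[mu]_2[EFin \o (f \- g)%R]) ->
  exists2 z, z \in L2 & \forall x \ae mu, z x = Phi z x.
Proof.
move=> q01 Phi2 lip; have /andP[q0 q1] := q01.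
pose u n := iter n Phi (cst 0%R).
have u2 n : u n \in L2.
  elim: n => [|n IH]; last exact: Phi2.
  by apply/Lfun2P; split => //; rewrite Lnorm0// eqe.
have m2 f : f \in L2 -> measurable_fun setT f by move=> /Lfun2P[].
pose C := fine 'N[mu]_2[EFin \o (u 1%N \- u 0%N)%R].
have C0 : (0 <= C)%R by rewrite fine_ge0// Lnorm_ge0.
have Nu n : 'N[mu]_2[EFin \o (u n.+1 \- u n)%R] <= (C * q ^+ n)%:E.
  elim: n => [|n IH].
    by rewrite expr0 mulr1 /C fineK//; apply: Lfun2_norm_fin; exact: Lfun2B.
  apply: (le_trans (lip _ _ (u2 n.+1) (u2 n))).
  by rewrite exprS mulrCA EFinM lee_wpmul2l ?lee_fin.
have [z mz hz] := Lnorm2_complete_geometric C0 q01 (fun n => m2 _ (u2 n)) Nu.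
have z2 : z \in L2.
  apply/Lfun2P; split => //.
  have -> : z = ((z \- u 0%N) \+ u 0%N)%R by apply/funext => x /=; rewrite subrK.
  apply: (le_lt_trans (Lnorm2D_le _ _)) => //; first exact: measurable_funB.
  rewrite lte_add_pinfty//; last by have /Lfun2P[] := u2 0%N.
  by rewrite (le_lt_trans (hz 0%N))// ltry.
exists z => //; apply: Lnorm2_sub_eq0 => //; first exact/m2/Phi2.
(* Compare z and Phi z with the iterate u n.+1 = Phi (u n). *)
have h n : 'N[mu]_2[EFin \o (z \- Phi z)%R] <= (2 * (C * q ^+ n / (1 - q)))%:E.
  have K0 : (0 <= C * q ^+ n / (1 - q))%R.
    by rewrite divr_ge0 ?mulr_ge0 ?exprn_ge0// subr_ge0 ltW.
  have mPz : measurable_fun setT (Phi z) by exact/m2/Phi2.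
  apply: (le_trans (Lnorm2_triangle mz (m2 _ (u2 n.+1)) mPz)).
  rewrite mulr_natl mulr2n [leRHS]EFinD leeD//.
    apply: (le_trans (hz _)); rewrite lee_fin.
    rewrite ler_wpM2r//; first by rewrite invr_ge0 subr_ge0 ltW.
    by rewrite exprS mulrCA ler_piMl ?mulr_ge0 ?exprn_ge0// ltW.
  apply: (le_trans (lip _ _ (u2 n) z2)).
  rewrite Lnorm2B_sym (le_trans (lee_wpmul2l _ (hz n))) ?lee_fin//.
  by rewrite ler_piMl// ltW.
apply/eqP; rewrite eq_le Lnorm_ge0 andbT.
have c0 : (2 * (C * q ^+ n / (1 - q)))%:E @[n --> \oo] --> 0.
  apply: cvg_EFin; first exact: nearW.
  under eq_fun do rewrite mulrAC mulrA.
  by apply: cvg_geometric; rewrite ger0_norm.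
by apply: (cvge_to_ge c0); exact: nearW.
Qed.
End contraction_principle.

(** * Integral operators with square-integrable kernels *)

Section kernel_operator.
Context d (T : measurableType d) (R : realType)
  (mu : {finite_measure set T -> \bar R}).
Local Open Scope ereal_scope.
Local Notation L2 := (Lfun mu 2%:E).

(** The value is that of the real-valued integral, hence 0 at the points x where
the integral is infinite or undefined. *)
Definition kernel_op (K : T -> T -> R) (g : T -> R) (x : T) : R :=
  (\int[mu]_y (K x y * g y))%R.

Definition square_integrable_kernel (K : T -> T -> R) :=
  (fun p => K p.1 p.2) \in Lfun (mu \x mu) 2%:E.

Lemma Lfun2_snd (g : T -> R) : g \in L2 ->
  (fun p : T * T => g p.2) \in Lfun (mu \x mu) 2%:E.
Proof.
move=> g2; have /Lfun2P[mg Ng] := g2.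
have mg' : measurable_fun setT (fun p : T * T => g p.2) by exact: measurableT_comp.
apply/Lfun2P; split => //.
rewrite unlock poweR_lty// fubini_tonelli1; last 2 first.
- by apply: measurable_abse_sqr; exact/measurable_EFinP.
- by move=> x; exact: poweR_ge0.
rewrite (eq_integral (cst (\int[mu]_y (`|(EFin \o g) y| `^ 2))))// integral_cst//.
rewrite lte_mul_pinfty//.
- by apply: integral_ge0 => x _; exact: poweR_ge0.
- rewrite ge0_fin_numE; last by apply: integral_ge0 => x _; exact: poweR_ge0.
  by move: Ng => /(poweR_lty 2); rewrite poweR_Lnorm.
- by rewrite ltey_eq fin_num_measure.
Qed.

Context (K : T -> T -> R) (K2 : square_integrable_kernel K).

Lemma measurable_kernel_section x : measurable_fun setT (K x).
Proof.
have /Lfun2P[mK _] := K2.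
exact: (measurableT_comp mK (measurable_pair1 x)).
Qed.

Lemma integrable_kernel_mul (g : T -> R) : g \in L2 ->
  (mu \x mu).-integrable setT (fun p => (K p.1 p.2 * g p.2)%:E).
Proof.
move=> g2; apply/Lfun1_integrable; apply: Lfun2_mul_Lfun1 => //.
exact: Lfun2_snd.
Qed.

Lemma measurable_kernel_op (g : T -> R) : g \in L2 ->
  measurable_fun setT (kernel_op K g).
Proof.
move=> /integrable_kernel_mul/measurable_fubini_F h.
by apply: (measurableT_comp _ h).
Qed.

Lemma ae_integrable_kernel_section (g : T -> R) : g \in L2 ->
  \forall x \ae mu, mu.-integrable setT (EFin \o (fun y => K x y * g y)%R).
Proof. by move=> /integrable_kernel_mul/ae_integrable1. Qed.

(** Linearity may fail where the sections are not integrable, which by Fubini's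
theorem is a null set. *)
Lemma kernel_opB (f g : T -> R) : f \in L2 -> g \in L2 ->
  \forall x \ae mu, (kernel_op K f x - kernel_op K g x = kernel_op K (f \- g) x)%R.
Proof.
move=> /ae_integrable_kernel_section hf /ae_integrable_kernel_section hg.
near=> x.
have ? : mu.-integrable setT (EFin \o (fun y => K x y * f y)%R) by near: x.
have ? : mu.-integrable setT (EFin \o (fun y => K x y * g y)%R) by near: x.
rewrite /kernel_op -RintegralB//; apply: eq_Rintegral => y _ /=.
by rewrite mulrBr.
Unshelve. all: by end_near. Qed.

Lemma kernel_opZ (c : R) (g : T -> R) : g \in L2 ->
  \forall x \ae mu, (kernel_op K (fun y => c * g y) x = c * kernel_op K g x)%R.
Proof.
move=> /ae_integrable_kernel_section; apply: filterS => x h.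
by rewrite /kernel_op -RintegralZl//; apply: eq_Rintegral => y _; rewrite mulrCA.
Qed.

(** Replaces alpha by another representative inside y |-> b (alpha y) (z y), where
the set of y with alpha y outside A is null but b is arbitrary on it. *)
Lemma kernel_op_ae_eq (f g : T -> R) : (\forall x \ae mu, f x = g x) ->
  kernel_op K f = kernel_op K g.
Proof.
move=> fg; apply/funext => x; congr fine; apply: ae_eq_integral_nonmeasurable.
by apply: filterS fg => y ->.
Qed.

(** Cauchy-Schwarz in the second variable. It holds for every x: when the integral
is not finite, its real value is 0. *)
Lemma abs_kernel_op_le (g : T -> R) x : g \in L2 ->
  `|kernel_op K g x|%:E <= 'N[mu]_2[EFin \o K x] * 'N[mu]_2[EFin \o g].
Proof.
move=> /Lfun2P[mg _]; have mKx := measurable_kernel_section x.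
have mKg : measurable_fun setT (EFin \o (K x \* g)%R).
  by apply/measurable_EFinP; exact: measurable_funM.
have half : (2^-1 + 2^-1 = 1 :> R)%R by rewrite [RHS]splitr !div1r.
apply: le_trans (hoelder mu mKx mg _ _ half) => //.
rewrite Lnorm1; apply: le_trans (le_abse_integral mu measurableT mKg).
rewrite /kernel_op /Rintegral -/(EFin \o _).
by case: (integral _ _ _) => [r| |] //=; rewrite ?normr0 ?leey.
Qed.

(** Integrating the Cauchy-Schwarz bound in x: the operator norm is at most the
Hilbert-Schmidt norm of the kernel. *)
Lemma Lnorm2_kernel_op_le (g : T -> R) : g \in L2 ->
  'N[mu]_2[EFin \o kernel_op K g] <=
    'N[mu \x mu]_2[EFin \o (fun p => K p.1 p.2)] * 'N[mu]_2[EFin \o g].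
Proof.
move=> g2; have /Lfun2P[mK NK] := K2; have [mg Ng] := (Lfun2P mu g).1 g2.
set NKK := 'N[mu \x mu]_2[_]; set Ngg := 'N[mu]_2[EFin \o g].
have NKfin : NKK \is a fin_num by exact: Lfun2_norm_fin.
have Ngfin : Ngg \is a fin_num by exact: Lfun2_norm_fin.
rewrite -(fineK NKfin) -(fineK Ngfin) -EFinM Lnorm2_leP; last first.
  by rewrite mulr_ge0// fine_ge0// Lnorm_ge0.
apply: (@le_trans _ _ (\int[mu]_x (('N[mu]_2[EFin \o K x] * Ngg) `^ 2))).
  apply: ae_ge0_le_integral_nonmeasurable => [x|x|]; rewrite ?poweR_ge0//.
  apply: nearW => x; apply: ge0_le_poweR => //; exact: abs_kernel_op_le.
under eq_integral do rewrite poweRM ?Lnorm_ge0// poweR_Lnorm//.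
have mF : measurable_fun setT
    (fun p => `|(EFin \o (fun p => K p.1 p.2)) p| `^ 2 : \bar R).
  by apply: measurable_abse_sqr; exact/measurable_EFinP.
have F0 (p : T * T) : 0 <= (`|(EFin \o (fun p => K p.1 p.2)) p| `^ 2 : \bar R).
  exact: poweR_ge0.
have tonelli : NKK `^ 2 = \int[mu]_x \int[mu]_y (`|(EFin \o K x) y| `^ 2).
  by rewrite /NKK poweR_Lnorm// fubini_tonelli1.
rewrite ge0_integralZr//; last 3 first.
- by apply: (measurable_fun_fubini_tonelli_F
    (fun p => `|(EFin \o (fun p => K p.1 p.2)) p| `^ 2) mF).
- by move=> x _; apply: integral_ge0 => y _; exact: poweR_ge0.
- exact: poweR_ge0.
rewrite -tonelli -poweRM ?Lnorm_ge0// -(fineK NKfin) -(fineK Ngfin) -EFinM.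
by rewrite poweR_EFin powR_mulrn// mulr_ge0// fine_ge0// Lnorm_ge0.
Qed.

End kernel_operator.

(** * Classes of square-integrable functions on the unit interval *)

Section L2I_classes.
Context (R : realType).
Local Notation L2 := (Lfun (lebI R) 2%:E).

Lemma ae_unit_itv : \forall x \ae lebI R, unit_itv R x.
Proof.
exists (~` unit_itv R); split.
- by apply: measurableC; exact: (@measurable_unit_itv R).
- by rewrite /lebI /= /mfrestr /mrestr setICl; exact: measure0.
- exact: subset_refl.
Qed.

Lemma L2I_Lfun (g : L2I R) : (g : R -> R) \in L2.
Proof.
apply/Lfun2P; split; last exact: (@Lebesgue_finite _ _ _ _ _ _ g).
exact: (@measurable_funPT _ _ _ _ (repr (LebesgueSpace.sort g))).
Qed.

Lemma L2I_of_Lfun (f : R -> R) : f \in L2 ->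
  exists c : L2I R, \forall x \ae lebI R, c x = f x.
Proof.
move=> /Lfun2P[mf Nf].
pose F : {mfun measurableTypeR R >-> measurableTypeR R} :=
  HB.pack f
    (@isMeasurableFun.Build _ _ (measurableTypeR R) (measurableTypeR R) f mf).
pose Q := {mfun_ (lebI R), (measurableTypeR R) >-> (measurableTypeR R)}.
pose c : {mfun_ (lebI R), (measurableTypeR R) >-> (measurableTypeR R)} :=
  (\pi_Q F)%qT.
have cf : \forall x \ae lebI R, c x = f x.
  have : (repr c == F %[mod Q])%qT by rewrite reprK.
  by rewrite eqquotE => /asboolP; apply: filterS => x /(_ I).
have Nc : finite_norm (lebI R) 2%:E c.
  apply: le_lt_trans Nf; rewrite le_eqVlt; apply/orP; left; apply/eqP.
  by apply: Lnorm2_ae_eq; apply: filterS cf => x /= ->.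
exists (HB.pack_for (LspaceType (lebI R) (lee1n 2)) c
  (@isFinLebesgue.Build _ _ _ _ _ (lee1n 2) c Nc)).
exact: cf.
Qed.

Lemma L2I_ext (c c' : L2I R) : (\forall x \ae lebI R, c x = c' x) -> c = c'.
Proof.
move=> cc'.
have : LebesgueSpace.sort c = LebesgueSpace.sort c'.
  rewrite -[LHS]reprK -[RHS]reprK; apply/eqquotP/asboolP.
  by apply: filterS cc' => x e _.
move: c c' {cc'} => [c [[Nc]]] [c' [[Nc']]] /= e.
rewrite -e in Nc' *.
by rewrite (Prop_irrelevance Nc Nc').
Qed.
End L2I_classes.

(** * The graphon operator and its norm *)

Section graphon_operator.
Context (R : realType) (w : R -> R -> R) (w_graphon : graphon w).
Local Notation L2 := (Lfun (lebI R) 2%:E).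
Local Notation I2 := (unit_itv R `*` unit_itv R).

(** The graphon extended by 0 outside the unit square. The graphon is measurable on
the square only, and the integral operators above use kernels measurable on the
whole product; the measure [lebI] does not see the difference. *)
Definition graphon_kernel (x y : measurableTypeR R) : R :=
  ((fun p => w p.1 p.2) \_ I2) (x, y).

Lemma graphon_kernel_sqint : square_integrable_kernel (lebI R) graphon_kernel.
Proof.
have mI2 : measurable (I2 : set (measurableTypeR R * measurableTypeR R)).
  by apply: measurableX; exact: (@measurable_unit_itv R).
have kernelE :
    (fun p : measurableTypeR R * measurableTypeR R => graphon_kernel p.1 p.2) =
    (fun p => w p.1 p.2) \_ I2.
  by apply/funext => -[x y].
have mw := @graphon_meas R w w_graphon.
rewrite /square_integrable_kernel kernelE; apply: Lfun2_of_sqr_integrable.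
  exact: ((measurable_restrictT _ mI2).1 mw).
have := graphon_sqint w_graphon; rewrite [X in (X < _)%E -> _]integral_mkcond.
apply: le_lt_trans; rewrite le_eqVlt; apply/orP; left; apply/eqP.
by apply: eq_integral => p _; rewrite /patch; case: ifP => //=; rewrite expr0n.
Qed.

Lemma graphon_opE (g : R -> R) x : unit_itv R x ->
  graphon_op w g x = kernel_op (lebI R) graphon_kernel g x.
Proof.
move=> Ix; congr fine; rewrite integral_mkcond; apply: eq_integral => y _.
rewrite /graphon_kernel /patch in_setX/= (mem_set Ix)/=.
by case: ifP => //; rewrite mul0r.
Qed.

Lemma ae_graphon_opE (g : R -> R) : \forall x \ae lebI R,
  graphon_op w g x = kernel_op (lebI R) graphon_kernel g x.
Proof. by apply: ae_imp (ae_unit_itv R) => x; exact: graphon_opE. Qed.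

Lemma Lnorm2_graphon_op (g : R -> R) :
  ('N[lebI R]_2[EFin \o graphon_op w g] =
   'N[lebI R]_2[EFin \o kernel_op (lebI R) graphon_kernel g])%E.
Proof.
by apply: Lnorm2_ae_eq; apply: ae_imp (ae_graphon_opE g) => x /= ->.
Qed.

Let S : set (\bar R) := [set 'N[lebI R]_2[EFin \o graphon_op w g]%E
                  | g in [set g : L2I R | ('N[lebI R]_2[EFin \o g] <= 1)%E]].

(** The value at the zero class is nonnegative and belongs to S, so the supremum is
not that of an empty set. *)
Let sup_ge0 : (0 <= ereal_sup S)%E.
Proof.
have [c c0] : exists c : L2I R, \forall x \ae lebI R, c x = cst 0 x.
  by apply: L2I_of_Lfun; apply/Lfun2P; split => //; rewrite Lnorm0// eqe.
have Nc : 'N[lebI R]_2[EFin \o c]%E = 0%E.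
  rewrite (@Lnorm2_ae_eq _ _ _ _ _ (cst 0%E)) ?Lnorm0 ?eqe//.
  by apply: ae_imp c0 => x /= ->.
have Sc : S 'N[lebI R]_2[EFin \o graphon_op w c]%E.
  by exists c => //=; rewrite Nc lee_fin.
by apply: le_trans (ereal_sup_ubound Sc); exact: Lnorm_ge0.
Qed.

(** The Hilbert-Schmidt norm bounds the supremum, so that [graphon_opnorm], its
real value, is the supremum itself. *)
Let sup_fin : ereal_sup S \is a fin_num.
Proof.
have /Lfun2P[_ Kfin] := graphon_kernel_sqint.
rewrite ge0_fin_numE//; apply: le_lt_trans Kfin.
apply: ge_ereal_sup => _ [g /= g1 <-]; rewrite Lnorm2_graphon_op.
apply: (le_trans (Lnorm2_kernel_op_le graphon_kernel_sqint (L2I_Lfun g))).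
by rewrite -[leRHS]mule1 lee_wpmul2l// Lnorm_ge0.
Qed.

Lemma graphon_opnorm_ge0 : 0 <= graphon_opnorm w.
Proof. exact: fine_ge0. Qed.

(** By homogeneity, from the class of g / ||g||. When ||g|| = 0 the Hilbert-Schmidt
bound is used instead. *)
Lemma Lnorm2_kernel_op_le_opnorm (g : R -> R) : g \in L2 ->
  ('N[lebI R]_2[EFin \o kernel_op (lebI R) graphon_kernel g] <=
   (graphon_opnorm w)%:E * 'N[lebI R]_2[EFin \o g])%E.
Proof.
move=> g2; have Ngfin := Lfun2_norm_fin g2.
have [N0|N0] := eqVneq ('N[lebI R]_2[EFin \o g])%E 0%E.
  by have := Lnorm2_kernel_op_le graphon_kernel_sqint g2; rewrite N0 !mule0.
set N := fine ('N[lebI R]_2[EFin \o g])%E.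
have NE : ('N[lebI R]_2[EFin \o g] = N%:E)%E by rewrite fineK.
have N_gt0 : 0 < N.
  by rewrite lt_neqAle -lee_fin -eqe eq_sym -NE N0 Lnorm_ge0.
pose h x := N^-1 * g x.
have h2 : h \in L2.
  have /Lfun2P[mg Ng] := g2; apply/Lfun2P; split; first exact: measurable_funM.
  by rewrite Lnorm2Z// lte_mul_pinfty// lee_fin.
have Nh : ('N[lebI R]_2[EFin \o h] = 1)%E.
  by rewrite Lnorm2Z// NE -EFinM ger0_norm ?invr_ge0 ?ltW// mulVf ?gt_eqF.
have [c ch] := L2I_of_Lfun h2.
have Nc : 'N[lebI R]_2[EFin \o c]%E = 1%E.
  by rewrite -Nh; apply: Lnorm2_ae_eq; apply: ae_imp ch => x /= ->.
have Sc : S 'N[lebI R]_2[EFin \o kernel_op (lebI R) graphon_kernel h]%E.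
  exists c => /=; last by rewrite Lnorm2_graphon_op (kernel_op_ae_eq _ ch).
  by rewrite Nc.
have : ('N[lebI R]_2[EFin \o kernel_op (lebI R) graphon_kernel h] <=
    (graphon_opnorm w)%:E)%E.
  by rewrite /graphon_opnorm fineK//; exact: ereal_sup_ubound.
rewrite (@Lnorm2_ae_eq _ _ _ _ _
  (EFin \o (fun x => N^-1 * kernel_op (lebI R) graphon_kernel g x))); last first.
  by apply: ae_imp (kernel_opZ graphon_kernel_sqint N^-1 g2) => x /= ->.
rewrite Lnorm2Z; last first.
  apply/Lfun2P; split; first exact: measurable_kernel_op graphon_kernel_sqint _ g2.
  apply: (le_lt_trans (Lnorm2_kernel_op_le graphon_kernel_sqint g2)).
  have /Lfun2P[_ NK] := graphon_kernel_sqint; have /Lfun2P[_ Ng] := g2.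
  by rewrite lte_mul_pinfty// ?Lnorm_ge0// ge0_fin_numE// Lnorm_ge0.
have Ni0 : 0 <= N^-1 by rewrite invr_ge0 ltW.
rewrite ger0_norm// => h1.
rewrite [X in (_ * X)%E](_ : _ = N%:E); last exact: NE.
have := lee_wpmul2l _ h1 => /(_ N%:E); rewrite muleA -EFinM mulfV ?gt_eqF//.
by rewrite mul1e muleC; apply; rewrite lee_fin ltW.
Qed.
End graphon_operator.

(** * Strongly convex functions on a set of reals *)

Lemma convex_set_segment (R : realType) (A : set R) :
  convex_set (A : set (convex_lmodType R^o)) ->
  forall a a' eps, A a -> A a' -> 0 <= eps <= 1 -> A (eps * a + (1 - eps) * a').
Proof.
move=> cA a a' eps Aa Aa' /andP[e0 e1].
by have := cA a a' (Itv01 e0 e1); rewrite !inE => /(_ Aa Aa').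
Qed.

Section strongly_convex.
Context (R : realType) (A : set R)
  (A_convex : forall a a' eps, A a -> A a' -> 0 <= eps <= 1 ->
     A (eps * a + (1 - eps) * a'))
  (g : R -> R) (l : R) (l_gt0 : 0 < l)
  (g_diff : forall x, A x -> cvg (diff_quot_within A g x))
  (g_convex : forall a a' eps, A a -> A a' -> 0 <= eps <= 1 ->
     g (eps * a + (1 - eps) * a') <= eps * g a + (1 - eps) * g a' -
       l / 2 * eps * (1 - eps) * `|a - a'| ^+ 2).
Local Notation g' := (derive_within A g).

(** Convexity keeps the segment from x to y in A, so the difference quotients along
it converge to the derivative within A. *)
Lemma derive_within_segment x y : A x -> A y -> x != y ->
  (g (e * y + (1 - e) * x) - g x) / (e * y + (1 - e) * x - x) @[e --> 0^'+] -->
    g' x.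
Proof.
move=> Ax Ay xy.
pose s e := e * y + (1 - e) * x.
have sE e : s e - x = e * (y - x) by rewrite /s; ring.
have s_within : s e @[e --> 0^'+] --> within A x^'.
  move=> U [eps /= eps0 epsU].
  have yx0 : 0 < `|y - x| by rewrite normr_gt0 subr_eq0 eq_sym.
  suff : \forall e \near (0 : R)^'+, U (s e) by [].
  near=> e.
  have e0 : 0 < e by near: e; exact: nbhs_right_gt.
  have e1 : e <= 1 by near: e; exact: nbhs_right_le.
  have es : e < eps / `|y - x| by near: e; apply: nbhs_right_lt; rewrite divr_gt0.
  apply: epsU.
  - by rewrite /ball_ /= distrC sE normrM gtr0_norm// -ltr_pdivlMr.
  - rewrite -subr_eq0 sE; apply: mulf_neq0; first by rewrite gt_eqF.
    by rewrite subr_eq0 eq_sym.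
  - by apply: A_convex => //; rewrite ltW.
have := g_diff Ax; rewrite /derive_within => c.
exact: (cvg_comp _ _ s_within c).
Unshelve. all: by end_near. Qed.

(** Strong convexity bounds the difference quotient of g along the segment from x
to y; let the step tend to 0. *)
Lemma strong_tangent x y : A x -> A y ->
  g x + g' x * (y - x) + l / 2 * (y - x) ^+ 2 <= g y.
Proof.
move=> Ax Ay; have [<-|xy] := eqVneq x y.
  by rewrite subrr expr0n !mulr0 !addr0.
have h := derive_within_segment Ax Ay xy.
rewrite -subr_ge0.
(* For e in (0, 1], H e >= 0 is the convexity inequality at e * y + (1 - e) * x,
   divided by e. *)
pose H e := g y - (g x +
  (g (e * y + (1 - e) * x) - g x) / (e * y + (1 - e) * x - x) * (y - x) +
  l / 2 * (1 - e) * (y - x) ^+ 2).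
have cH : H e @[e --> 0^'+] -->
    g y - (g x + g' x * (y - x) + l / 2 * (y - x) ^+ 2).
  rewrite /H; apply: cvgB; first exact: cvg_cst.
  apply: cvgD.
    by apply: cvgD; [exact: cvg_cst|apply: cvgMr_tmp].
  apply: cvgMr_tmp; rewrite -[X in _ --> X]mulr1; apply: cvgMl_tmp.
  rewrite -[X in _ --> X](subr0 1); apply: cvgB; first exact: cvg_cst.
  by apply: cvg_at_right_filter; exact: cvg_id.
apply: (cvgr_to_ge cH).
near=> e.
have e0 : 0 < e by near: e; exact: nbhs_right_gt.
have e1 : e <= 1 by near: e; exact: nbhs_right_le.
have := g_convex Ay Ax (_ : 0 <= e <= 1); rewrite (ltW e0) e1 => /(_ isT).
rewrite /H (_ : e * y + (1 - e) * x - x = e * (y - x)); last by ring.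
rewrite real_normK ?num_real// => hc.
rewrite -(pmulr_rge0 _ e0).
have yx0 : y - x != 0 by rewrite subr_eq0 eq_sym.
have e_neq0 : e != 0 by rewrite gt_eqF.
rewrite [X in g x + X](_ : _ = (g (e * y + (1 - e) * x) - g x) / e); last first.
  by field; rewrite e_neq0.
have -> : e * (g y - (g x + (g (e * y + (1 - e) * x) - g x) / e +
    l / 2 * (1 - e) * (y - x) ^+ 2)) = e * g y + (1 - e) * g x -
       l / 2 * e * (1 - e) * (y - x) ^+ 2 - g (e * y + (1 - e) * x).
  by field.
by rewrite subr_ge0.
Unshelve. all: by end_near. Qed.

(** Sum of [strong_tangent] at x and at y. *)
Lemma derive_within_strong_mono x y : A x -> A y ->
  l * (x - y) ^+ 2 <= (g' x - g' y) * (x - y).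
Proof.
move=> Ax Ay; have := strong_tangent Ax Ay; have := strong_tangent Ay Ax.
rewrite (_ : (y - x) ^+ 2 = (x - y) ^+ 2); last by rewrite -sqrrN opprB.
lra.
Qed.

Lemma minimizer_variational x y : A x -> A y -> (forall t, A t -> g x <= g t) ->
  0 <= g' x * (y - x).
Proof.
move=> Ax Ay xmin; have [<-|xy] := eqVneq x y; first by rewrite subrr mulr0.
have h := derive_within_segment Ax Ay xy.
have cH : (g (e * y + (1 - e) * x) - g x) / (e * y + (1 - e) * x - x) * (y - x)
    @[e --> 0^'+] --> g' x * (y - x) by exact: cvgMr_tmp.
apply: (cvgr_to_ge cH); near=> e.
have e0 : 0 < e by near: e; exact: nbhs_right_gt.
have e1 : e <= 1 by near: e; exact: nbhs_right_le.
have yx0 : y - x != 0 by rewrite subr_eq0 eq_sym.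
have e_neq0 : e != 0 by rewrite gt_eqF.
rewrite (_ : e * y + (1 - e) * x - x = e * (y - x)); last by ring.
rewrite (_ : _ * _ = (g (e * y + (1 - e) * x) - g x) / e); last first.
  by field; rewrite e_neq0.
rewrite divr_ge0 ?subr_ge0 ?(ltW e0)// xmin//.
by apply: A_convex; rewrite ?(ltW e0).
Unshelve. all: by end_near. Qed.

Lemma continuous_within_differentiable : {within A, continuous g}.
Proof.
apply/subspace_continuousP => x Ax; apply/cvgrPdist_lt => e e0.
have /cvgrPdist_lt/(_ _ ltr01) := g_diff Ax.
rewrite -/(derive_within A g x); set L := derive_within A g x => hq.
have hq' : \forall y \near within A (nbhs x),
    y != x -> `|L - (g y - g x) / (y - x)| < 1.
  move: hq => [eps /= eps0 hq]; exists eps => //= y xy Ay yx; exact: hq.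
have K0 : 0 < `|L| + 1 by rewrite ltr_wpDl.
near=> y.
have [->|yx] := eqVneq y x; first by rewrite subrr normr0.
have hy : `|L - (g y - g x) / (y - x)| < 1 by move: yx; near: y.
have yx0 : y - x != 0 by rewrite subr_eq0.
have -> : g x - g y = - ((g y - g x) / (y - x)) * (y - x) by field.
have : `|(g y - g x) / (y - x)| < `|L| + 1.
  by rewrite -[X in `|X|](subKr L) (le_lt_trans (ler_normB _ _))// ltrD2l.
move=> hq1.
have hd : `|x - y| < e / (`|L| + 1).
  by near: y; exists (e / (`|L| + 1)) => /=; [rewrite divr_gt0|move=> y].
rewrite normrM normrN distrC in hd *; rewrite distrC in hd.
apply: (@le_lt_trans _ _ ((`|L| + 1) * `|y - x|)).
  by rewrite ler_wpM2r// ltW.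
by rewrite mulrC -ltr_pdivlMr// distrC.
Unshelve. all: by end_near. Qed.

(** The quadratic lower bound of [strong_tangent] at a point a0 of A confines the
competitors of a0 to a compact interval, where the extreme value theorem applies. *)
Lemma strongly_convex_minimizer : closed A -> A !=set0 ->
  exists2 c, A c & forall t, A t -> g c <= g t.
Proof.
move=> A_closed [a0 Aa0].
(* For |t - a0| > K the quadratic term dominates the linear one. *)
pose K := 2 * `|g' a0| / l.
pose I := `[a0 - K, a0 + K]%classic.
have K0 : 0 <= K by rewrite divr_ge0 ?mulr_ge0// ltW.
have Ia0 : I a0 by rewrite /I /= in_itv/= lerBlDr lerDl K0.
have compactAI : compact (A `&` I).
  apply: (@subclosed_compact _ _ I) => //; last exact: segment_compact.
  by apply: closedI => //; exact: itv_closed.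
have contAI : {within A `&` I, continuous g}.
  by apply: continuous_subspaceW continuous_within_differentiable => x [].
have AI0 : A `&` I !=set0 by exists a0.
have [c /set_mem[Ac Ic] cmin] := compact_EVT_min AI0 compactAI contAI.
exists c => // t At; have [It|It] := pselect (I t).
  by apply: cmin; apply: mem_set.
apply: (@le_trans _ _ (g a0)); first by apply: cmin; apply: mem_set.
apply: (le_trans _ (strong_tangent Aa0 At)).
rewrite -addrA lerDl.
have Kt : K < `|t - a0|.
  rewrite ltNge; apply: contra_notN It; rewrite ler_norml => /andP[h1 h2].
  by rewrite /I /= in_itv/=; apply/andP; split; lra.
have : - (`|g' a0| * `|t - a0|) <= g' a0 * (t - a0).
  by rewrite -normrM lerNl (le_trans (ler_norm _))// normrN.
have : `|g' a0| * `|t - a0| <= l / 2 * (t - a0) ^+ 2.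
  rewrite -[(t - a0) ^+ 2]real_normK ?num_real// expr2 mulrA ler_wpM2r//.
  by move: (ltW Kt); rewrite /K ler_pdivrMr// => h; lra.
lra.
Qed.

End strongly_convex.

(** * Best responses *)

Section best_response.
Context (R : realType) (A : set R)
  (A_convex : forall a a' eps, A a -> A a' -> 0 <= eps <= 1 ->
     A (eps * a + (1 - eps) * a'))
  (J : R -> R -> R) (l_c l_J : R) (l_c_gt0 : 0 < l_c)
  (J_diff : forall z x, A x -> cvg (diff_quot_within A (J^~ z) x))
  (J_convex : forall a a' z eps, A a -> A a' -> 0 <= eps <= 1 ->
     J (eps * a + (1 - eps) * a') z <= eps * J a z + (1 - eps) * J a' z -
       l_c / 2 * eps * (1 - eps) * `|a - a'| ^+ 2)
  (dJ_lipschitz : forall a z z', A a ->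
     `|derive_within A (J^~ z') a - derive_within A (J^~ z) a|
       <= l_J * `|z' - z|).

Definition is_best_response (z a : R) : Prop :=
  A a /\ forall t, A t -> J a z <= J t z.

(** The first-order conditions at a and a' are compared through the strong
monotonicity of the derivative at z. With z' = z this is uniqueness of the best
response. *)
Lemma best_response_lipschitz z z' a a' :
  is_best_response z a -> is_best_response z' a' ->
  l_c * `|a - a'| <= l_J * `|z - z'|.
Proof.
move=> [Aa amin] [Aa' amin'].
have [->|aa'] := eqVneq a a'.
  rewrite subrr normr0 mulr0.
  by have := dJ_lipschitz z' z Aa; apply: le_trans; exact: normr_ge0.
have n0 : 0 < `|a - a'| by rewrite normr_gt0 subr_eq0.
have conv0 u v eps (Au : A u) (Av : A v) := J_convex z Au Av (eps := eps).
have v1 := minimizer_variational A_convex (@J_diff z) Aa Aa' amin.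
have v2 := minimizer_variational A_convex (@J_diff z') Aa' Aa amin'.
have m := derive_within_strong_mono A_convex (@J_diff z) conv0 Aa Aa'.
have d := dJ_lipschitz z z' Aa'.
rewrite -(ler_pM2r n0) -mulrA -expr2 real_normK ?num_real//.
set p := derive_within A (J^~ z) a in v1 m.
set p' := derive_within A (J^~ z) a' in m d.
set q' := derive_within A (J^~ z') a' in v2 d.
(* Strong monotonicity at z and the two first-order conditions. *)
apply: (@le_trans _ _ ((q' - p') * (a - a'))); first by lra.
apply: (le_trans (ler_norm _)); rewrite normrM (distrC z).
by rewrite ler_wpM2r.
Qed.

Lemma exists_best_response : closed A -> A !=set0 ->
  exists phi : R -> R, forall z, is_best_response z (phi z).
Proof.
move=> A_closed A_nonempty.
suff /choice[phi hphi] : forall z, exists a, is_best_response z a by exists phi.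
move=> z; have conv u v eps (Au : A u) (Av : A v) := J_convex z Au Av (eps := eps).
have [a Aa ha] := strongly_convex_minimizer A_convex l_c_gt0 (@J_diff z) conv
  A_closed A_nonempty.
by exists a.
Qed.

End best_response.

(** * Lipschitz superposition operators *)

(** The weighted square bound is weakened to a bound linear in the increments by
comparing squares: the cross term is nonnegative. *)
Lemma norm_le_of_sqr_le (R : realType) (c_a c_z u s t : R) : 0 <= c_a -> 0 <= c_z ->
  0 <= s -> 0 <= t ->
  `|u| ^+ 2 <= c_a * s ^+ 2 + c_z * t ^+ 2 ->
  `|u| <= Num.sqrt c_a * s + Num.sqrt c_z * t.
Proof.
move=> ca cz s0 t0 h.
rewrite -(@ler_pXn2r _ 2) ?nnegrE ?addr_ge0 ?mulr_ge0 ?sqrtr_ge0//.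
apply: (le_trans h); rewrite sqrrD !exprMn !sqr_sqrtr//.
by rewrite lerD2r lerDl mulrn_wge0// !mulr_ge0 ?sqrtr_ge0.
Qed.

Section superposition.
Context d (T : measurableType d) (R : realType)
  (mu : {finite_measure set T -> \bar R}).
Local Notation L2 := (Lfun mu 2%:E).
Context (G : R -> R -> R) (p r : R) (p_ge0 : 0 <= p) (r_ge0 : 0 <= r)
  (G_lipschitz : forall s t s' t',
     `|G s t - G s' t'| <= p * `|s - s'| + r * `|t - t'|).

Lemma continuous_lipschitz_fst t : continuous (G^~ t).
Proof.
have p1 : 0 < p + 1 by rewrite ltr_wpDl.
move=> s; apply/cvgrPdist_lt => e e0; near=> u.
apply: (le_lt_trans (G_lipschitz s t u t)); rewrite subrr normr0 mulr0 addr0.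
apply: (@le_lt_trans _ _ ((p + 1) * `|s - u|)).
  by rewrite ler_wpM2r// lerDl.
rewrite mulrC -ltr_pdivlMr//; near: u.
by exists (e / (p + 1)) => /=; [rewrite divr_gt0|].
Unshelve. all: by end_near. Qed.

(** A sublevel set of G (s x) (t x) is a countable union over rationals q:
G (s x) q + r |t x - q| is an upper bound of G (s x) (t x), arbitrarily close to it
when q is close to t x, and it is measurable because G is continuous in its first
argument. *)
Lemma measurable_superposition (s t : T -> R) : measurable_fun setT s ->
  measurable_fun setT t -> measurable_fun setT (fun x => G (s x) (t x)).
Proof.
move=> ms mt mT; apply: (measurability _ (RGenInftyO.measurableE R)) => //.
move=> /= _ [_ [a ->] <-]; rewrite setTI.
rewrite [X in measurable X](_ : _ = \bigcup_(q : rat)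
  [set x | G (s x) (ratr q) + r * `|t x - ratr q| < a]); last first.
  apply/seteqP; split=> [x /=|x [q _] /=]; rewrite in_itv/=.
    (* r + 1 instead of r, since r may be 0. *)
    move=> Ga; pose eps := (a - G (s x) (t x)) / (2 * (r + 1)).
    have r1 : 0 < r + 1 by rewrite ltr_wpDl.
    have eps0 : 0 < eps by rewrite divr_gt0 ?subr_gt0// mulr_gt0.
    have [|q] := @rat_in_itvoo _ (t x - eps) (t x + eps).
      by rewrite ltrD2l; apply: (lt_trans _ eps0); rewrite oppr_lt0.
    rewrite in_itv/= => /andP[q1 q2].
    exists q => //=.
    have tq : `|t x - ratr q| < eps by rewrite ltr_norml; apply/andP; split; lra.
    have hG := G_lipschitz (s x) (ratr q) (s x) (t x).
    move: hG; rewrite subrr normr0 mulr0 add0r distrC => hG.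
    have h1 : r * `|t x - ratr q| <= (r + 1) * `|t x - ratr q|.
      by rewrite ler_wpM2r// lerDl.
    have h2 : (r + 1) * `|t x - ratr q| < (a - G (s x) (t x)) / 2.
      have -> : (a - G (s x) (t x)) / 2 = (r + 1) * eps.
        by rewrite /eps; field; rewrite gt_eqF.
      by rewrite ltr_pM2l.
    have h3 : G (s x) (ratr q) - G (s x) (t x) <= r * `|t x - ratr q|.
      apply: le_trans (ler_norm _) _; rewrite distrC.
      by rewrite (distrC (t x)) in hG *.
    lra.
  apply: le_lt_trans.
  have hG := G_lipschitz (s x) (t x) (s x) (ratr q).
  move: hG; rewrite subrr normr0 mulr0 add0r => hG.
  by rewrite -lerBlDl (le_trans (ler_norm _)).
apply: bigcupT_measurable_rat => q.
have mh : measurable_fun setT (fun x => G (s x) (ratr q) + r * `|t x - ratr q|).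
  apply: measurable_funD.
    have mG : measurable_fun setT (G^~ (ratr q)).
      by apply: continuous_measurable_fun; exact: continuous_lipschitz_fst.
    exact: (measurableT_comp mG ms).
  apply: measurable_funM => //; apply: measurableT_comp => //.
  exact: measurable_funB.
by have := mh measurableT _ (measurable_itv `]-oo, a[);
  rewrite setTI (_ : _ @^-1` _ =
    [set x | G (s x) (ratr q) + r * `|t x - ratr q| < a]).
Qed.

Lemma Lfun2_superposition (s t : T -> R) : s \in L2 -> t \in L2 ->
  (fun x => G (s x) (t x)) \in L2.
Proof.
move=> s2 t2; have /Lfun2P[ms _] := s2; have /Lfun2P[mt _] := t2.
apply/Lfun2P; split; first exact: measurable_superposition.
pose h := cst `|G 0 0| \+ ((fun x => p * `|s x|) \+ (fun x => r * `|t x|)).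
have /Lfun2P[_ Nh] : h \in L2.
  apply: Lfun2D; first exact: Lfun_cst.
  by apply: Lfun2D; apply: Lfun2Z; exact: Lfun2_norm.
apply: le_lt_trans Nh; apply: Lnorm2_ae_le; apply: nearW => x.
rewrite /= lee_fin [leRHS]ger0_norm; last by rewrite !addr_ge0 ?mulr_ge0.
rewrite -[X in `|X|](subrK (G 0 0)) addrC (le_trans (ler_normD _ _))// lerD2l.
by have := G_lipschitz (s x) (t x) 0 0; rewrite !subr0.
Qed.

Lemma Lnorm2_superposition (s t s' t' : T -> R) :
  s \in L2 -> t \in L2 -> s' \in L2 -> t' \in L2 ->
  ('N[mu]_2[EFin \o ((fun x => G (s x) (t x)) \- (fun x => G (s' x) (t' x)))%R]
   <= p%:E * 'N[mu]_2[EFin \o (s \- s')%R] +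
      r%:E * 'N[mu]_2[EFin \o (t \- t')%R])%E.
Proof.
move=> s2 t2 s2' t2'.
have ds := Lfun2B s2 s2'; have dt := Lfun2B t2 t2'.
have Nabs f : ('N[mu]_2[EFin \o (fun x => `|f x|)%R] = 'N[mu]_2[EFin \o f])%E.
  by rewrite -(Lnorm_abse mu (EFin \o f)).
rewrite -(Nabs (s \- s')) -(Nabs (t \- t')).
have a2 := Lfun2_norm ds; have b2 := Lfun2_norm dt.
have pE : p%:E = `|p|%:E :> \bar R by rewrite ger0_norm.
have rE : r%:E = `|r|%:E :> \bar R by rewrite ger0_norm.
rewrite pE rE.
rewrite -(Lnorm2Z p a2) -(Lnorm2Z r b2).
have /Lfun2P[ma _] := Lfun2Z p a2; have /Lfun2P[mb _] := Lfun2Z r b2.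
apply: (le_trans _ (Lnorm2D_le mu ma mb)); apply: Lnorm2_ae_le; apply: nearW => x.
by rewrite /= lee_fin [leRHS]ger0_norm ?addr_ge0 ?mulr_ge0.
Qed.
End superposition.

(** * The fixed-point equation for the aggregate *)

Section graphon_response.
Context (R : realType) (w : R -> R -> R) (w_graphon : graphon w).
Local Notation L2 := (Lfun (lebI R) 2%:E).
Local Notation W := (graphon_opnorm w).
Local Notation Wop := (kernel_op (lebI R) (graphon_kernel w)).
Context (G : R -> R -> R) (p r : R) (p_ge0 : 0 <= p) (r_ge0 : 0 <= r)
  (G_lipschitz : forall s t s' t',
     `|G s t - G s' t'| <= p * `|s - s'| + r * `|t - t'|).

(** The right-hand side of the aggregate equation with two independent arguments:
s determines the actions, t enters b directly. The diagonal s = t is the equilibrium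
equation, and a frozen s is the aggregate equation of a fixed profile. *)
Definition response (s t : R -> R) : R -> R := Wop (fun y => G (s y) (t y)).

Lemma response_Lfun2 (s t : R -> R) : s \in L2 -> t \in L2 -> response s t \in L2.
Proof.
move=> s2 t2; have K2 := graphon_kernel_sqint w_graphon.
have G2 := Lfun2_superposition p_ge0 r_ge0 G_lipschitz s2 t2.
apply/Lfun2P; split; first exact: measurable_kernel_op K2 _ G2.
apply: (le_lt_trans (Lnorm2_kernel_op_le_opnorm w_graphon G2)).
have /Lfun2P[_ NG] := G2.
by rewrite lte_mul_pinfty// lee_fin graphon_opnorm_ge0.
Qed.

Lemma Lnorm2_response (s t s' t' : R -> R) :
  s \in L2 -> t \in L2 -> s' \in L2 -> t' \in L2 ->
  ('N[lebI R]_2[EFin \o (response s t \- response s' t')%R] <=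
   W%:E * (p%:E * 'N[lebI R]_2[EFin \o (s \- s')%R] +
           r%:E * 'N[lebI R]_2[EFin \o (t \- t')%R]))%E.
Proof.
move=> s2 t2 s2' t2'; have K2 := graphon_kernel_sqint w_graphon.
have G2 := Lfun2_superposition p_ge0 r_ge0 G_lipschitz s2 t2.
have G2' := Lfun2_superposition p_ge0 r_ge0 G_lipschitz s2' t2'.
apply: (@le_trans _ _ ('N[lebI R]_2[EFin \o
    Wop ((fun y => G (s y) (t y)) \- (fun y => G (s' y) (t' y)))%R])%E).
  rewrite le_eqVlt; apply/orP; left; apply/eqP; apply: Lnorm2_ae_eq.
  by apply: ae_imp (kernel_opB K2 G2 G2') => x /= ->.
apply: (le_trans (Lnorm2_kernel_op_le_opnorm w_graphon (Lfun2B G2 G2'))).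
rewrite lee_wpmul2l ?lee_fin ?graphon_opnorm_ge0//.
exact: Lnorm2_superposition.
Qed.

Context (contraction : W * (p + r) < 1).

Lemma Lnorm2_response_diag (s t : R -> R) : s \in L2 -> t \in L2 ->
  ('N[lebI R]_2[EFin \o (response s s \- response t t)%R] <=
   (W * (p + r))%:E * 'N[lebI R]_2[EFin \o (s \- t)%R])%E.
Proof.
move=> s2 t2; apply: (le_trans (Lnorm2_response s2 s2 t2 t2)).
by rewrite -ge0_muleDl ?lee_fin// -EFinD muleA -EFinM.
Qed.

Lemma exists_response_fixpoint :
  exists2 z, z \in L2 & \forall x \ae lebI R, z x = response z z x.
Proof.
have q01 : 0 <= W * (p + r) < 1.
  by rewrite contraction andbT mulr_ge0 ?addr_ge0 ?graphon_opnorm_ge0.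
have Phi2 z : z \in L2 -> response z z \in L2 by move=> z2; exact: response_Lfun2.
exact: (Lfun2_contraction_fixpoint q01 Phi2 Lnorm2_response_diag).
Qed.

Lemma response_fixpoint_unique (z z' : R -> R) : z \in L2 -> z' \in L2 ->
  (\forall x \ae lebI R, z x = response z z x) ->
  (\forall x \ae lebI R, z' x = response z' z' x) ->
  \forall x \ae lebI R, z x = z' x.
Proof.
move=> z2 z2' hz hz'; apply: (Lfun2_contraction_unique contraction) => //.
apply: le_trans (Lnorm2_response_diag z2 z2').
rewrite le_eqVlt; apply/orP; left; apply/eqP; apply: Lnorm2_ae_eq.
by apply: ae_imp2 hz hz' => x /= <- <-.
Qed.

(** With s frozen, the Lipschitz constant in t is W * r, which is at most
W * (p + r). *)
Lemma response_snd_unique (s z z' : R -> R) : s \in L2 -> z \in L2 -> z' \in L2 ->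
  (\forall x \ae lebI R, z x = response s z x) ->
  (\forall x \ae lebI R, z' x = response s z' x) ->
  \forall x \ae lebI R, z x = z' x.
Proof.
move=> s2 z2 z2' hz hz'.
have Wr : W * r < 1.
  apply: le_lt_trans contraction; rewrite ler_wpM2l ?graphon_opnorm_ge0//.
  by rewrite lerDr.
apply: (Lfun2_contraction_unique Wr) => //.
have := Lnorm2_response s2 z2 s2 z2'.
rewrite [X in (_ * (_ * X + _))%E](_ : _ = 0%E); last first.
  rewrite (_ : EFin \o _ = cst 0%E) ?Lnorm0 ?eqe//.
  by apply/funext => x /=; rewrite subrr.
rewrite mule0 add0e muleA -EFinM; apply: le_trans.
rewrite le_eqVlt; apply/orP; left; apply/eqP; apply: Lnorm2_ae_eq.
by apply: ae_imp2 hz hz' => x /= <- <-.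
Qed.
End graphon_response.

(** alpha is replaced by phi \o s inside the integral by [kernel_op_ae_eq]. *)
Lemma aggregate_equation_response (R : realType) (w b : R -> R -> R)
    (phi s : R -> R) (alpha z : L2I R) :
  (\forall x \ae lebI R, alpha x = phi (s x)) ->
  aggregate_equation w b alpha z <->
  \forall x \ae lebI R, z x = response w (fun s t => b (phi s) t) s z x.
Proof.
move=> alphaE.
have E : kernel_op (lebI R) (graphon_kernel w) (fun y => b (alpha y) (z y)) =
    response w (fun s t => b (phi s) t) s z.
  by apply: kernel_op_ae_eq; apply: ae_imp alphaE => y ->.
have := ae_graphon_opE w (fun y => b (alpha y) (z y)); rewrite E => h.
by split=> hz; apply: ae_imp2 hz h => x -> ->.
Qed.

Theorem proposition3p17 (R : realType) (A : set R)
  (A_nonempty : A !=set0) (A_closed : closed A)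
  (A_convex : convex_set (A : set (convex_lmodType R^o)))
  (mu0 : probability (measurableTypeR R) R) (mu0_mean_zero : mean_zero mu0)
  (d : measure_display) (Omega : measurableType d) (P : probability Omega R)
  (xi0 : {RV P >-> measurableTypeR R})
  (xi0_law : forall B : set (measurableTypeR R), measurable B ->
     distribution P xi0 B = mu0 B)
  (b : R -> R -> R) (f : R -> R -> R -> R)
  (J_well_defined : forall a z, A a ->
     P.-integrable setT (EFin \o realized_cost xi0 b f a z))
  (c_a c_z l_c l_J : R)
  (c_a_ge0 : 0 <= c_a) (c_z_ge0 : 0 <= c_z) (l_c_gt0 : 0 < l_c)
  (l_J_ge0 : 0 <= l_J)
  (w : R -> R -> R) (w_graphon : graphon w)
  (b_lipschitz : forall a z a' z', A a -> A a' ->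
     `|b a z - b a' z'| ^+ 2 <= c_a * `|a - a'| ^+ 2 + c_z * `|z - z'| ^+ 2)
  (xi0_sqint : ('E_P[fun omega => (xi0 omega ^+ 2)%R] < +oo)%E)
  (J_C1 : forall z,
     continuously_differentiable_on A (fun a => expected_cost xi0 b f a z))
  (J_strongly_convex : forall a a' z eps, A a -> A a' -> 0 <= eps <= 1 ->
     expected_cost xi0 b f (eps * a + (1 - eps) * a') z <=
       eps * expected_cost xi0 b f a z +
       (1 - eps) * expected_cost xi0 b f a' z -
       l_c / 2 * eps * (1 - eps) * `|a - a'| ^+ 2)
  (dJ_lipschitz : forall a z z', A a ->
     `|derive_within A (fun a0 => expected_cost xi0 b f a0 z') a -
       derive_within A (fun a0 => expected_cost xi0 b f a0 z) a|
       <= l_J * `|z' - z|)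
  (c_z_W_lt1 : Num.sqrt c_z * graphon_opnorm w < 1)
  (contraction_bound :
     l_J / l_c * (Num.sqrt c_a * graphon_opnorm w /
                  (1 - Num.sqrt c_z * graphon_opnorm w)) < 1) :
  exists! alpha : L2I R,
    nash_equilibrium A w b (expected_cost xi0 b f) alpha.
Proof.
set J := expected_cost xi0 b f.
have A_conv := convex_set_segment A_convex.
have J_diff z x : A x -> cvg (diff_quot_within A (J^~ z) x).
  by move=> Ax; have [h _] := J_C1 z; exact: h.
have [phi phiP] := exists_best_response A_conv l_c_gt0 J_diff J_strongly_convex
  A_closed A_nonempty.
have phi_unique z a : is_best_response A J z a -> a = phi z.
  move=> az; have := best_response_lipschitz A_conv J_diff
    J_strongly_convex dJ_lipschitz az (phiP z).
  rewrite subrr normr0 mulr0 pmulr_rle0// normr_le0 subr_eq0.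
  by move=> /eqP.
have phi_lip z z' : `|phi z - phi z'| <= l_J / l_c * `|z - z'|.
  rewrite mulrAC ler_pdivlMr// mulrC.
  exact: (best_response_lipschitz A_conv J_diff
    J_strongly_convex dJ_lipschitz (phiP z) (phiP z')).
(* Lipschitz constants of b (phi s) t in s and in t. *)
pose p := Num.sqrt c_a * (l_J / l_c); pose r := Num.sqrt c_z.
have p_ge0 : 0 <= p by rewrite mulr_ge0 ?sqrtr_ge0// divr_ge0// ltW.
have r_ge0 : 0 <= r by exact: sqrtr_ge0.
pose G s t := b (phi s) t.
have G_lip s t s' t' : `|G s t - G s' t'| <= p * `|s - s'| + r * `|t - t'|.
  apply: (@le_trans _ _ (Num.sqrt c_a * `|phi s - phi s'| + r * `|t - t'|)).
    apply: norm_le_of_sqr_le => //; apply: b_lipschitz.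
      by have [] := phiP s.
    by have [] := phiP s'.
  by rewrite lerD2r /p -mulrA ler_wpM2l ?sqrtr_ge0.
have contraction : graphon_opnorm w * (p + r) < 1.
  have D0 : 0 < 1 - Num.sqrt c_z * graphon_opnorm w by rewrite subr_gt0.
  move: contraction_bound; rewrite mulrA ltr_pdivrMr// mul1r /p /r.
  by move=> h; rewrite mulrDr; lra.
have [z0 z0_L2 z0_fix] :=
  exists_response_fixpoint w_graphon p_ge0 r_ge0 G_lip contraction.
have phi_z0_L2 : (fun x => phi (z0 x)) \in Lfun (lebI R) 2%:E.
  have L_ge0 : 0 <= l_J / l_c by rewrite divr_ge0// ltW.
  have lip (s t s' t' : R) : `|phi s - phi s'| <= l_J / l_c * `|s - s'| + 0 * `|t - t'|.
    by rewrite mul0r addr0.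
  exact: (Lfun2_superposition (G := fun s _ => phi s) L_ge0 (lexx 0) lip
    z0_L2 z0_L2).
have [z zE] := L2I_of_Lfun z0_L2.
have [alpha alphaE] := L2I_of_Lfun phi_z0_L2.
have z_L2 := L2I_Lfun z.
have responseE : response w G z z = response w G z0 z0.
  have GzE : \forall y \ae lebI R, G (z y) (z y) = G (z0 y) (z0 y).
    by apply: ae_imp zE => y ->.
  exact: (kernel_op_ae_eq _ GzE).
have z_fix : \forall x \ae lebI R, z x = response w G z z x.
  by rewrite responseE; apply: ae_imp2 zE z0_fix => x -> ->.
have alphaz : \forall x \ae lebI R, alpha x = phi (z x).
  by apply: ae_imp2 zE alphaE => x -> ->.
exists alpha; split.
- split; first by apply: ae_imp alphaz => x ->; have [] := phiP (z x).
  exists z; last first.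
    by apply: ae_imp alphaz => x -> t At; have [_] := phiP (z x); exact.
  split; first exact/(aggregate_equation_response w b z alphaz).
  move=> z' /(aggregate_equation_response w b z' alphaz) hz'.
  apply: L2I_ext.
  exact: (response_snd_unique w_graphon p_ge0 r_ge0 G_lip contraction
    z_L2 z_L2 (L2I_Lfun z') z_fix hz').
- move=> alpha' [adm [z' [agg _] best]].
  have alphaz' : \forall x \ae lebI R, alpha' x = phi (z' x).
    by apply: ae_imp2 adm best => x Ax hx; apply: phi_unique.
  move: agg => /(aggregate_equation_response w b z' alphaz') z'_fix.
  have zz' := response_fixpoint_unique w_graphon p_ge0 r_ge0 G_lip contraction
    z_L2 (L2I_Lfun z') z_fix z'_fix.
  apply: L2I_ext; apply: ae_imp2 zz' (filterI alphaz alphaz') => x zx [-> ->].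
  by rewrite zx.
Qed.
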